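(* Let $n$ and $k$ be non-negative integers with $k < n/2$. Then $$\binom{n}{k} \leq \binom{n}{k+1}.$$
   Context: Here $\binom{n}{k}$ denotes the binomial coefficient, i.e. the number of $k$-element subsets of an $n$-element set, equivalently $\frac{n!}{k!(n-k)!}$ for $0\le k\le n$. *)

(* Defs.v *)
From mathcomp Require Export all_boot all_order all_algebra.

(* Main.v *)
Require Import Defs.

(** By the identity [(k + 1) * 'C(n, k + 1) = (n - k) * 'C(n, k)] ([mul_bin_left]),
    the ratio of the two coefficients is [(n - k) / (k + 1)], which is at least
    1 because [2 k < n] between integers means [k + 1 <= n - k]. *)

(* The quotient n/2 is taken in rat: n./2 would be the floor, a stronger
   hypothesis when n is odd. *)
Theorem mainTheorem1 (n k : nat) (hk : (k%:R < n%:R / 2%:R :> rat)%R) :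
  'C(n, k) <= 'C(n, k.+1).
Proof.
have lt2k : k * 2 < n.
  by move: hk; rewrite Num.Theory.ltr_pdivlMr // -GRing.natrM Num.Theory.ltr_nat.
rewrite -(leq_pmul2l (ltn0Sn k)) mul_bin_left leq_mul2r.
by rewrite ltn_subRL addnn -muln2 lt2k orbT.
Qed.
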